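(* Let $\mathcal{T}$ be a self-affine tiling of $\mathbb{R}^d$ with expansion map $Q$ and a primitive substitution rule $\omega$ with finite local complexity. Suppose $Q$ is diagonalizable over $\mathbb{C}$ and all eigenvalues of $Q$ are algebraic conjugates of one another, each with the same multiplicity $J$. If there exists an algebraic conjugate $\beta$ of the eigenvalues of $Q$ with $|\beta|<1$, then for every return vector $x\in\mathbb{R}^d\setminus\{0\}$ of $\mathcal{T}$ there is $n_0\in\mathbb{N}$ such that $T+nx\notin\mathcal{T}$ for all $n>n_0$ and all $T\in\mathcal{T}$. Consequently, for each $T\in\mathcal{T}$ and each such $x\neq 0$ there is $n_0>0$ such that $\bigcup_{k=1}^{n_0}(T+kx)$ is not $\mathcal{T}$-legal.
   Context: A tile in $\mathbb{R}^d$ is a compact set equal to the closure of its interior, possibly carrying a label from a fixed finite set; $T+x$ denotes the translate. A patch is a set of tiles any two distinct members of which have disjoint interiors; its support is the closure of the union of the supports. A tiling is a patch with support $\mathbb{R}^d$. A patch $\mathcal{P}$ is $\mathcal{T}$-legal if $\mathcal{P}+x\subset\mathcal{T}$ for some $x$. For a patch $\mathcal{P}$ and $S\subset\mathbb{R}^d$, $\mathcal{P}\sqcap S=\{T\in\mathcal{P}:\operatorname{supp}T\cap S\neq\emptyset\}$. A tiling $\mathcal{T}$ has finite local complexity (FLC) if for each compact $K$ the set $\{\mathcal{T}\sqcap(K+x):x\in\mathbb{R}^d\}$ is finite up to translation, and is repetitive if for every finite $\mathcal{T}$-legal patch $\mathcal{P}$ there is $R>0$ such that every ball of radius $R$ contains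 the support of some translate $\mathcal{P}+x\subset\mathcal{T}$. A return vector of $\mathcal{T}$ is an $x$ such that $T\in\mathcal{T}$ and $T+x\in\mathcal{T}$ for some tile $T$. A substitution rule consists of a finite set $\mathcal{A}$ of prototiles, a linear expansion map $Q$ (all eigenvalues of modulus $>1$), and a map $\omega$ assigning to each $P\in\mathcal{A}$ a finite patch of translates of prototiles with $\operatorname{supp}\omega(P)=Q(\operatorname{supp}P)$, extended by $\omega(P+x)=\omega(P)+Qx$ and unions. It is primitive if some power of its substitution matrix (entry $(i,j)$ = number of translates of the $i$-th prototile in $\omega$ of the $j$-th) is positive, and has FLC if for each compact $K$ the set $\{\omega^n(P)\sqcap(K+x): n>0,P\in\mathcal{A},x\in\mathbb{R}^d\}$ is finite up to translation. A self-affine tiling for $\omega$ is a tiling consisting of translates of prototiles with $\omega(\mathcal{T})=\mathcal{T}$, having FLC and being repetitive. *)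

(* Defs.v *)
From HB Require Import structures.
From mathcomp Require Import all_boot all_order all_algebra.
From mathcomp Require Import complex.
From mathcomp Require Import all_classical all_reals all_analysis.

Set Implicit Arguments.
Unset Strict Implicit.
Unset Printing Implicit Defensive.

Import Order.TTheory GRing.Theory Num.Theory.
Import numFieldNormedType.Exports.
Local Open Scope classical_set_scope.
Local Open Scope ring_scope.

Section Tilings.
Variables (R : realType) (d : nat) (L : finType).

Local Notation V := 'rV[R]_d.

Record tile := Tile { supp : set V ; lab : L }.

Definition is_tile (T : tile) : Prop :=
  compact (supp T) /\ closure (interior (supp T)) = supp T.

Definition trset (S : set V) (x : V) : set V := [set y + x | y in S].
Definition trtile (T : tile) (x : V) : tile := Tile (trset (supp T) x) (lab T).
Definition trpatch (P : set tile) (x : V) : set tile :=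
  [set trtile T x | T in P].

Definition is_patch (P : set tile) : Prop :=
  (forall T, P T -> is_tile T) /\
  (forall T T', P T -> P T' -> T <> T' ->
     interior (supp T) `&` interior (supp T') = set0).

Definition psupp (P : set tile) : set V :=
  closure (\bigcup_(T in P) supp T).

Definition is_tiling (P : set tile) : Prop := is_patch P /\ psupp P = setT.

Definition legal (Tl P : set tile) : Prop :=
  exists x : V, trpatch P x `<=` Tl.

Definition pcap (P : set tile) (S : set V) : set tile :=
  [set T | P T /\ supp T `&` S !=set0].

Definition finite_up_to_translation (I : Type) (F : I -> set tile) : Prop :=
  exists Ps : seq (set tile),
    forall i, exists2 P, P \in Ps & exists y : V, F i = trpatch P y.

Definition FLC (Tl : set tile) : Prop :=
  forall K : set V, compact K ->
    finite_up_to_translation (fun x : V => pcap Tl (trset K x)).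

Definition repetitive (Tl : set tile) : Prop :=
  forall P : set tile, finite_set P -> legal Tl P ->
    exists2 r : R, 0 < r &
      forall z : V, exists x : V,
        trpatch P x `<=` Tl /\ psupp (trpatch P x) `<=` ball z r.

Definition return_vector (Tl : set tile) (x : V) : Prop :=
  exists T, Tl T /\ Tl (trtile T x).

Definition lin (Q : 'M[R]_d) (v : V) : V := v *m Q.

Definition cplx (x : R) : R[i] := Complex x 0.
Definition QC (Q : 'M[R]_d) : 'M[R[i]]_d := map_mx cplx Q.
Definition ceigen (Q : 'M[R]_d) (z : R[i]) : Prop := eigenvalue (QC Q) z.

Definition expansion (Q : 'M[R]_d) : Prop :=
  forall z, ceigen Q z -> 1 < `|z|.

(* A substitution rule with m prototiles proto : 'I_m -> tile, expansion Q,
   and omega i = finite list of (index j, translation y) meaning the tile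
   proto j + y; i.e. omega(P_i) = { P_j + y | (j,y) in omega i }. *)
Variable m : nat.

Definition omega_proto (proto : 'I_m -> tile) (omega : 'I_m -> seq ('I_m * V))
  (i : 'I_m) : set tile :=
  [set T | exists2 jy, jy \in omega i & T = trtile (proto jy.1) jy.2].

Definition omegaP (Q : 'M[R]_d) (proto : 'I_m -> tile)
  (omega : 'I_m -> seq ('I_m * V)) (P : set tile) : set tile :=
  \bigcup_(ix in [set ix : 'I_m * V | P (trtile (proto ix.1) ix.2)])
     trpatch (omega_proto proto omega ix.1) (lin Q ix.2).

Definition is_subst_rule (Q : 'M[R]_d) (proto : 'I_m -> tile)
  (omega : 'I_m -> seq ('I_m * V)) : Prop :=
  expansion Q /\
  (forall i, is_tile (proto i)) /\
  (forall i, is_patch (omega_proto proto omega i) /\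
     psupp (omega_proto proto omega i) = lin Q @` supp (proto i)).

Definition subst_matrix (omega : 'I_m -> seq ('I_m * V)) : 'M[int]_m :=
  \matrix_(i, j) (count (fun jy : 'I_m * V => jy.1 == i) (omega j))%:Z.

Definition primitive (omega : 'I_m -> seq ('I_m * V)) : Prop :=
  exists2 k : nat, (0 < k)%N &
    forall i j, 0 < (subst_matrix omega ^+ k) i j.

Definition subst_FLC (Q : 'M[R]_d) (proto : 'I_m -> tile)
  (omega : 'I_m -> seq ('I_m * V)) : Prop :=
  forall K : set V, compact K ->
    finite_up_to_translation
      (fun nix : nat * 'I_m * V =>
         pcap (iter nix.1.1.+1 (omegaP Q proto omega)
                    [set proto nix.1.2]) (trset K nix.2)).

Definition self_affine (Q : 'M[R]_d) (proto : 'I_m -> tile)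
  (omega : 'I_m -> seq ('I_m * V)) (Tl : set tile) : Prop :=
  [/\ is_tiling Tl,
      (forall T, Tl T -> exists i x, T = trtile (proto i) x),
      omegaP Q proto omega Tl = Tl,
      FLC Tl & repetitive Tl].

End Tilings.

(* Main.v *)
(* Since [p] is irreducible and [p(Q) = 0], the ring [K := Q[X]/(p)] is a field
   acting on R^d through [Q].  A [K]-linear functional that is nonzero at [x],
   followed by the embedding [K -> C] sending [X] to [beta], is an additive map
   [f : R^d -> C] with [f (v Q) = beta f v] and [f x = 1].  As [omega Tl = Tl],
   every tile position is [y = z Q + t], where [z] is the position of a parent
   tile and [t] ranges over a finite set.  Positions of distant ancestors lie in
   a fixed ball, hence in a finite set, and [|beta| < 1], so [f] is bounded on
   tile positions.  If [T] and [T + n x] are both tiles then [n = f (n x)] is a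
   difference of two such values.  Primitivity serves only to exclude prototiles
   with empty support. *)

Require Import Defs.
From HB Require Import structures.
From mathcomp Require Import all_boot all_order all_algebra.
From mathcomp Require Import complex ring lra.
From mathcomp Require Import all_classical all_reals all_analysis.

Set Implicit Arguments.
Unset Strict Implicit.
Unset Printing Implicit Defensive.

Import Order.TTheory GRing.Theory Num.Theory.
Import numFieldNormedType.Exports ComplexField.Normc.
Local Open Scope classical_set_scope.
Local Open Scope ring_scope.

(** * Equivariant functionals over [F[X]/(p)] *)

(* Zorn gives a submodule [H] maximal among those avoiding [x]; it is a
   complement of the line through [x]. *)
Lemma exists_equivariant_functional (F K C : fieldType) (n : nat)
  (A : {rmorphism {poly F} -> 'M[K]_n}) (ev : {rmorphism {poly F} -> C})
  (p : {poly F}) (x : 'rV[K]_n) :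
  irreducible_poly p -> A p = 0 -> ev p = 0 -> x != 0 ->
  exists f : 'rV[K]_n -> C,
    [/\ forall u v, f (u + v) = f u + f v,
        forall q v, f (v *m A q) = ev q * f v
      & f x = 1].
Proof.
move=> p_irr Ap evp x0.
(* Membership of 0 is not part of [closedA], so that the empty union, which arises from the empty
   chain in Zorn's lemma, qualifies. Maximality then gives [H0], by comparing [H] with [H] together
   with 0. *)
pose closedA (H : set 'rV[K]_n) := (forall u v, H u -> H v -> H (u + v)) /\
  (forall q v, H v -> H (v *m A q)).
have [|H [[[HD HM] Hx] Hmax]] := @Zorn_bigcup _ [set H | closedA H /\ ~ H x].
  move=> G GP Gtot; split; first split.
  - move=> u v [B GB Bu] [B' GB' B'v].
    have [BB'|B'B] := Gtot _ _ GB GB'.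
      by exists B' => //; apply: (GP _ GB').1.1 => //; exact: BB'.
    by exists B => //; apply: (GP _ GB).1.1 => //; exact: B'B.
  - by move=> q v [B GB Bv]; exists B => //; exact: (GP _ GB).1.2.
  - by move=> [B GB Bx]; exact: (GP _ GB).2.
have maxH B : closedA B -> H `<=` B -> ~ B x -> B `<=` H.
  move=> Bcl HB Bx; apply: contrapT => BH.
  by apply: (Hmax B).
have H0 : H 0.
  apply: (maxH [set v | H v \/ v = 0]); last by right.
  - split=> [u v [Hu|->] [Hv|->]|q v [Hv|->]]; rewrite ?addr0 ?add0r ?mul0mx;
      by [right|left; auto|left].
  - by left.
  - by case=> // xE; rewrite xE eqxx in x0.
have HN v : H v -> H (- v).
  by move=> Hv; have := HM (-1) _ Hv; rewrite rmorphN1 mulmxN mulmx1.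
have bezout q : ~~ (p %| q) -> exists b, A b *m A q = 1%:M /\ A q *m A b = 1%:M.
  move=> pq; have : coprimep p q by rewrite irreducible_poly_coprime.
  move=> /Bezout_eq1_coprimepP[[a b] /= ab]; exists b.
  have E : A (b * q) = 1%:M.
    have := congr1 A ab; rewrite rmorphD rmorphM /= Ap mulr0 add0r => ->.
    by rewrite rmorph1.
  by split; [rewrite -[LHS]/(A b * A q)|rewrite -[LHS]/(A q * A b)];
    rewrite -rmorphM // mulrC.
have dvdA q : p %| q -> A q = 0.
  by move=> /divpK <-; rewrite rmorphM /= Ap mulr0.
(* Maximality is applied to [B], the sum of [H] and the submodule generated by [v]. Either [B]
   avoids [x] and [v] lies in [H], or [x = h + v *m A q] with [A q] invertible, which can be solved
   for [v] modulo [H]. *)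
have decomp v : exists q, H (v - x *m A q).
  pose B : set 'rV[K]_n := [set w | exists h q, H h /\ w = h + v *m A q].
  have Bcl : closedA B.
    split=> [_ _ [h [q [Hh ->]]] [h' [q' [Hh' ->]]]|r _ [h [q [Hh ->]]]].
      exists (h + h'), (q + q'); split; first exact: HD.
      by rewrite rmorphD mulmxDr addrACA.
    exists (h *m A r), (q * r); split; first exact: HM.
    by rewrite mulmxDl -mulmxA rmorphM.
  have HB : H `<=` B.
    by move=> h Hh; exists h, 0; rewrite rmorph0 mulmx0 addr0.
  have [|nBx] := pselect (B x); last first.
    exists 0; rewrite rmorph0 mulmx0 subr0; apply: (maxH B) => //.
    by exists 0, 1; rewrite rmorph1 mulmx1 add0r.
  move=> [h [q [Hh xE]]].
  have [/dvdA Aq0|/bezout[b [_ qb]]] := boolP (p %| q).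
    by exfalso; apply: Hx; rewrite xE Aq0 mulmx0 addr0.
  exists b; rewrite {1}xE mulmxDl -mulmxA qb mulmx1 opprD addrCA subrr addr0.
  exact/HN/HM.
have unicity q : H (x *m A q) -> ev q = 0.
  have [/divpK <- _|/bezout[b [_ qb]] Hq] := boolP (p %| q).
    by rewrite rmorphM /= evp mulr0.
  by exfalso; apply: Hx; rewrite -[x]mulmx1 -qb mulmxA; exact: HM.
have [g Hg] := choice decomp.
(* By [unicity], [ev (g v)] does not depend on the representative chosen by [g], so each property of
   [f] follows by exhibiting one convenient [q]. *)
have fE v q : H (v - x *m A q) -> ev (g v) = ev q.
  move=> Hq; apply/eqP; rewrite -subr_eq0 -rmorphB; apply/eqP/unicity.
  have := HD _ _ Hq (HN _ (Hg v)).
  by rewrite opprB addrC addrA subrK rmorphB mulmxBr.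
exists (ev \o g); split=> [u v|q v|] /=.
- rewrite -rmorphD; apply: fE; rewrite rmorphD mulmxDr opprD addrACA.
  exact: HD.
- rewrite -rmorphM; apply: fE.
  by rewrite mulrC rmorphM [_ * _]/(_ *m _) mulmxA -mulmxBl; exact: HM.
- by rewrite -(rmorph1 ev); apply: fE; rewrite rmorph1 mulmx1 subrr.
Qed.

(** * Diagonalizable matrices and a norm adapted to the expansion *)

Lemma diagonalizable_eigenbasis (F : fieldType) (n : nat) (A : 'M[F]_n) :
  diagonalizable A ->
  exists (P : 'M[F]_n) (D : 'rV[F]_n),
    [/\ P \in unitmx, P *m A = diag_mx D *m P
      & forall k, eigenvalue A (D 0 k)].
Proof.
move=> [P P_unit /diagonalizable_forPex[D /(simmxP P_unit) PAE]].
exists P, D; split=> // k; apply/eigenvalueP; exists (row k P).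
  rewrite -row_mul PAE; apply/rowP => j.
  by rewrite mxE mul_diag_mx !mxE.
apply/eqP => rowP0; have /matrixP/(_ 0 k)/eqP : delta_mx 0 k = 0 :> 'rV[F]_n.
  by rewrite -[LHS](mulmxK P_unit) -rowE rowP0 mul0mx.
by rewrite !mxE !eqxx oner_eq0.
Qed.

(** On a diagonal form [q] acts entrywise, so simple roots at the eigenvalues suffice whatever their
    multiplicities. *)
Lemma diagonalizable_horner0 (F : fieldType) (n : nat) (A : 'M[F]_n.+1)
  (q : {poly F}) :
  diagonalizable A -> (forall z, eigenvalue A z -> root q z) ->
  horner_mx A q = 0.
Proof.
move=> /diagonalizable_eigenbasis[P [D [P_unit /(simmxP P_unit) PAE Deig]]] q0.
have ->: A = conjmx (invmx P) (diag_mx D) by apply/(simmxLR P_unit).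
rewrite horner_mx_conj ?row_free_unit ?unitmx_inv ?stablemx_unit ?unitmx_inv//.
rewrite horner_mx_diag (_ : map_mx _ D = 0) ?linear0 ?conjmx0//.
by apply/matrixP => i j; rewrite !mxE (ord1 i); exact/rootP/q0/Deig.
Qed.

Lemma normc_sum (R : rcfType) (n : nat) (F : 'I_n -> R[i]) :
  normc (\sum_k F k) <= \sum_k normc (F k).
Proof.
elim/big_ind2: _ => [|z r z' r' le_zr le_zr'|//]; first by rewrite normc0.
by rewrite (le_trans (le_normcD _ _))// lerD.
Qed.

(** [N] is the l1 norm of the coordinates in a complex eigenbasis: there [Q] multiplies each
    coordinate by an eigenvalue, so one application already expands by [delta]. *)
Lemma expansion_norm (R : realType) (n : nat) (Q : 'M[R]_n) :
  diagonalizable (QC Q) -> expansion Q ->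
  exists (N : 'rV[R]_n -> R) (delta c : R),
    [/\ 1 < delta,
        forall v, 0 <= N v,
        forall u v, N (u - v) <= N u + N v,
        forall v, delta * N v <= N (v *m Q)
      & forall v, `|v| <= c * N v].
Proof.
move=> /diagonalizable_eigenbasis[P [D [P_unit PQE Deig]]] Qexp.
pose toC : 'rV[R]_n -> 'rV[R[i]]_n := map_mx (real_complex R).
pose w v := toC v *m invmx P.
have wQ v k : w (v *m Q) 0 k = D 0 k * w v 0 k.
  rewrite /w /toC map_mxM -[X in _ *m X *m _]/(QC Q).
  rewrite -[QC Q](mulKmx P_unit) PQE !mulmxA mulmxK // mul_mx_diag mxE.
  by rewrite mulrC.
exists (fun v => \sum_k normc (w v 0 k)).
(* The 2 is any number above 1; it is the value of the minimum in dimension 0. *)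
exists (\big[Order.min/2]_k normc (D 0 k)).
exists (\sum_k \sum_j normc (P k j)).
have nge0 (z : R[i]) : 0 <= normc z by case: z => a b; exact: sqrtr_ge0.
split.
- apply: lt_bigmin => [|k _]; first by rewrite ltr1n.
  by have := Qexp _ (Deig k); rewrite normc_def ltcR; case: (D 0 k).
- by move=> v; apply: sumr_ge0.
- move=> u v; rewrite -big_split; apply: ler_sum => k _ /=.
  rewrite /w /toC map_mxB mulmxBl [X in normc X]mxE [X in normc (_ + X)]mxE.
  by rewrite (le_trans (le_normcD _ _))// normcN.
- move=> v; rewrite mulr_sumr; apply: ler_sum => k _.
  by rewrite wQ normcM ler_wpM2r // bigmin_le.
- move=> v; rewrite -[leLHS]/(mx_norm v); have [->|/mx_norm_neq0[[i j] ->]] := eqVneq (mx_norm v) 0.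
    by rewrite mulr_ge0 ?sumr_ge0// => k _; exact: sumr_ge0.
  have vE : (v 0 j)%:C%C = \sum_k w v 0 k * P k j.
    by have /matrixP/(_ 0 j) := mulmxKV P_unit (toC v); rewrite !mxE => <-.
  have -> : `|v i j| = normc (v 0 j)%:C%C.
    by rewrite (ord1 i) /normc /= expr0n addr0 sqrtr_sqr.
  rewrite vE (le_trans (normc_sum _))// mulr_sumr; apply: ler_sum => k _.
  rewrite normcM mulrC; apply: ler_wpM2r => //.
  rewrite (bigD1 k)//= (bigD1 j)//= -addrA lerDl addr_ge0// ?sumr_ge0// => l _.
  exact: sumr_ge0.
Qed.

(** * Finiteness of bounded separated sets *)

Lemma finite_set_bounded (T : choiceType) (R : realType) (E : set T)
  (g : T -> R) :
  finite_set E -> exists B, forall y, E y -> g y <= B.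
Proof.
move=> /finite_seqP[s ->]; exists (\sum_(y <- s) `|g y|) => y /= ys.
by rewrite (big_rem y)//= (le_trans (ler_norm _))// lerDl sumr_ge0.
Qed.

(** Finitely many balls of radius [rho / 2] cover [E], and each contains at most one of its
    points. *)
Lemma separated_bounded_finite (R : realType) (n : nat) (E : set 'rV[R]_n)
  (rho : R) :
  0 < rho -> bounded_set E ->
  (forall y y', E y -> E y' -> `|y - y'| < rho -> y = y') ->
  finite_set E.
Proof.
move=> rho0 [r [_ rE]] sepE.
have r0 : 0 < `|r| + 1 by rewrite ltr_wpDl.
pose K : set 'rV[R]_n := closed_ball 0 (`|r| + 1).
have EK : E `<=` K.
  move=> y Ey; rewrite /K closed_ballE//= /closed_ball_/= sub0r normrN.
  by apply: (rE (`|r| + 1)) => //; rewrite (le_lt_trans (ler_norm _))// ltrDl.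
have cK : compact K.
  apply: bounded_closed_compact; last exact: closed_ball_closed.
  exists (`|r| + 1); split; first exact: num_real.
  move=> M rM y; rewrite /K closed_ballE//= /closed_ball_/= sub0r normrN => yr.
  exact: le_trans yr (ltW rM).
rewrite compact_cover in cK.
have [|y Ky|D _ KD] := cK _ K (fun y => ball y (rho / 2)).
- by move=> y _; exact: ball_open.
- by exists y => //; apply: ballxx; rewrite divr_gt0.
(* A ball that misses [E] gets the default 0, which only enlarges the finite image. *)
pose pt c := xget (0 : 'rV[R]_n) (E `&` ball c (rho / 2)).
apply: sub_finite_set (finite_image pt (finite_fset D)).
move=> y Ey; have [c Dc cy] := KD _ (EK _ Ey); exists c => //.
have /(xgetPex 0)[] : exists z, (E `&` ball c (rho / 2)) z by exists y.
rewrite -/(pt c); move: (pt c) => z Ez cz; apply: sepE => //.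
by have := ball_splitr cz cy; rewrite -ball_normE.
Qed.

(** * Translates of tiles and their positions *)

Lemma trset0 (R : realType) (n : nat) (S : set 'rV[R]_n) : trset S 0 = S.
Proof.
by rewrite /trset; under eq_imagel do rewrite addr0; rewrite image_id.
Qed.

Lemma trsetD (R : realType) (n : nat) (S : set 'rV[R]_n) u v :
  trset (trset S u) v = trset S (u + v).
Proof.
rewrite /trset image_comp; congr (_ @` _).
by apply/funext => y /=; rewrite addrA.
Qed.

Lemma trtileD (R : realType) (n : nat) (L : finType) (T : tile R n L) u v :
  trtile (trtile T u) v = trtile T (u + v).
Proof. by rewrite /trtile /= trsetD. Qed.

(** If two translates agree, [S] is invariant under [u - v], and a nonzero period would make it
    unbounded. *)
Lemma trset_inj (R : realType) (n : nat) (S : set 'rV[R]_n) :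
  compact S -> S !=set0 -> injective (trset S).
Proof.
move=> /compact_bounded[r [_ rS]] [s Ss] u v uv.
have per : trset S (u - v) = S by rewrite -trsetD uv trsetD subrr trset0.
have mem k : S (s + (u - v) *+ k).
  elim: k => [|k IH]; first by rewrite mulr0n addr0.
  by rewrite -per mulrSr addrA; exists (s + (u - v) *+ k).
apply: contrapT => /eqP; rewrite -subr_eq0 -normr_gt0 => uv0.
set e := `|u - v| in uv0.
have bnd k : e *+ k <= `|r| + 1 + `|s|.
  rewrite -normrMn -[_ *+ k](addKr s) addrC (le_trans (ler_normB _ _))//.
  by rewrite lerD2r rS// (le_lt_trans (ler_norm _))// ltrDl.
have B0 : 0 <= (`|r| + 1 + `|s|) / e by rewrite divr_ge0 ?addr_ge0// ltW.
have := archi_boundP B0; rewrite ltr_pdivrMr// mulrC mulr_natr.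
by rewrite ltNge bnd.
Qed.

Lemma trtile_inj (R : realType) (n : nat) (L : finType) (T : tile R n L) :
  is_tile T -> supp T !=set0 -> injective (trtile T).
Proof. by move=> [cT _] T0 u v [] /trset_inj; exact. Qed.

Lemma tile_contains_ball (R : realType) (n : nat) (L : finType)
  (T : tile R n L) :
  is_tile T -> supp T !=set0 ->
  exists (c : 'rV[R]_n) (rho : R), 0 < rho /\ ball c rho `<=` supp T.
Proof.
move=> [_ clT] [s]; rewrite -{1}clT => /(_ _ (nbhsx_ballx s _ ltr01))[c [cT _]].
have /nbhs_ballP[rho rho0 sub] : nbhs c (supp T) := cT.
by exists c, rho.
Qed.

(** When [y] and [y'] are closer than [rho], the point [c + y] is interior to both translates, so
    they are the same tile. *)
Lemma overlapping_translates (R : realType) (n : nat) (L : finType)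
  (T : tile R n L) (P : set (tile R n L)) (c : 'rV[R]_n) (rho : R) :
  is_patch P -> is_tile T -> supp T !=set0 ->
  ball c rho `<=` supp T ->
  forall y y', P (trtile T y) -> P (trtile T y') -> `|y - y'| < rho -> y = y'.
Proof.
move=> [_ disj] tT T0 sub y y' Py Py' yy'.
apply: (trtile_inj tT T0); apply: contrapT => /(disj _ _ Py Py').
have sub_tr z : ball (c + z) rho `<=` supp (trtile T z).
  move=> v; rewrite -ball_normE /= => vz; exists (v - z); last by rewrite subrK.
  by apply: sub; rewrite -ball_normE /= opprB addrA.
have int_tr z : nbhs (c + y) (ball (c + z) rho) -> (supp (trtile T z))° (c + y).
  by apply: filterS; exact: sub_tr.
move=> /seteqP[/(_ (c + y))+ _]; apply; split; apply: int_tr.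
  by apply: nbhsx_ballx; rewrite (le_lt_trans _ yy').
apply: open_nbhs_nbhs; split; first exact: ball_open.
by rewrite -ball_normE /= opprD addrACA subrr add0r -normrN opprB.
Qed.

(** * Contraction towards ancestors *)

Lemma expr_unbounded (R : archiRealFieldType) (a B : R) :
  1 < a -> exists k : nat, B <= a ^+ k.
Proof.
move=> a1; have a10 : 0 < a - 1 by rewrite subr_gt0.
have bern k : (a - 1) *+ k <= a ^+ k.
  suff : 1 + (a - 1) *+ k <= a ^+ k by apply: le_trans; rewrite lerDr.
  elim: k => [|k IH]; first by rewrite mulr0n addr0 expr0.
  have := exprn_ege1 k (ltW a1); rewrite exprS mulrSr; nra.
have [B0|/ltW B0] := leP 0 B; last by exists 0; rewrite expr0 (le_trans B0).
exists (Num.bound (B / (a - 1))); apply: le_trans (bern _).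
by rewrite -mulr_natl -ler_pdivrMr// ltW// archi_boundP// divr_ge0// ltW.
Qed.

(* Descending to parents contracts [N], so every element of [S] has an ancestor
   in the finite set [N <= K + 1]. *)
Lemma ancestral_bound (R : realType) (n : nat) (Q : 'M[R]_n)
  (S : set 'rV[R]_n) (s : seq 'rV[R]_n) (N g : 'rV[R]_n -> R) (delta b : R) :
  1 < delta ->
  (forall u v, N (u - v) <= N u + N v) ->
  (forall v, delta * N v <= N (v *m Q)) ->
  (forall r, finite_set [set y | S y /\ N y <= r]) ->
  (forall y, S y -> exists z o, [/\ S z, o \in s & y = z *m Q + o]) ->
  0 <= b < 1 ->
  (forall u v, g (u *m Q + v) <= b * g u + g v) ->
  exists C, forall y, S y -> g y <= C.
Proof.
move=> delta1 ND NQ Sfin Sanc /andP[b0 b1] gQ.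
have [c N_le] := finite_set_bounded N (finite_seq s).
have [B gB] := finite_set_bounded g (finite_seq s).
(* [K] is the fixed point of [r |-> (r + c) / delta], which bounds [N] of a parent in terms of [N]
   of its child. Hence the excess of [N] over [K] shrinks by [delta] per generation, and the
   induction on [k] ends at excess 1. *)
pose K := c / (delta - 1).
have KE : K + c = delta * K.
  by rewrite /K; field; rewrite subr_eq0 gt_eqF.
have [F gF] := finite_set_bounded g (Sfin (K + 1)).
(* Chosen so that [b * C + B <= C]: the bound passes from parent to child. *)
pose C := `|F| + `|B| / (1 - b).
have CE : b * C + B <= C.
  have b10 : 0 < 1 - b by rewrite subr_gt0.
  have := ler_norm B; have := normr_ge0 F.
  have : C = `|F| + `|B| / (1 - b) by [].
  have : (1 - b) * (`|B| / (1 - b)) = `|B|.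
    by rewrite mulrC divfK// gt_eqF.
  move: (`|B| / (1 - b)) => x; nra.
exists C => y Sy; have [k] := expr_unbounded (N y - K) delta1.
elim: k y Sy => [|k IH] y Sy Ny.
  have : g y <= F by apply: gF; split=> //; rewrite expr0 in Ny; lra.
  have : 0 <= `|B| / (1 - b) by rewrite divr_ge0// subr_ge0 ltW.
  have := ler_norm F; rewrite /C; lra.
have [z [t [Sz ts yE]]] := Sanc _ Sy.
have gz : g z <= C.
  apply: IH => //; have := NQ z; have := ND y t; have := N_le t ts.
  rewrite yE addrK -yE; rewrite exprS in Ny => No Nyo Nz.
  rewrite -(ler_pM2l (lt_trans ltr01 delta1)) mulrBr; lra.
rewrite yE; have := gQ z t; have := gB t ts.
have : b * g z <= b * C by rewrite ler_wpM2l.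
lra.
Qed.

(** * Prototiles, parents and ancestors in the tiling *)

(** The substitution image of an empty prototile has empty support, so every prototile in its
    iterates is empty. By primitivity these are all prototiles, and [Tl] could not cover the
    space. *)
Lemma primitive_proto_nonempty (R : realType) (d : nat) (L : finType) (m : nat)
  (proto : 'I_m -> tile R d L) (Q : 'M[R]_d)
  (omega : 'I_m -> seq ('I_m * 'rV[R]_d)) (Tl : set (tile R d L)) :
  is_subst_rule Q proto omega -> primitive omega -> psupp Tl = setT ->
  (forall T, Tl T -> exists i x, T = trtile (proto i) x) ->
  forall i, supp (proto i) !=set0.
Proof.
move=> [_ [_ psuppE]] [k0 _ Mpos] Tl_all Tl_proto i.
apply: contrapT => i0.
have empty_pow k j : (subst_matrix omega ^+ k) j i != 0 ->
    ~ (supp (proto j) !=set0).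
  elim: k j => [|k IH] j.
    by rewrite expr0 mxE; have [->|_] := eqVneq j i; rewrite ?eqxx.
  rewrite exprS mxE => Mji [v jv].
  have [l /andP[Mjl /IH l0]] : exists l,
      (subst_matrix omega j l != 0) && ((subst_matrix omega ^+ k) l i != 0).
    apply/existsP; apply: contraNT Mji => /existsPn Ml.
    rewrite big1// => l _; apply/eqP; rewrite mulf_eq0.
    by have := Ml l; rewrite negb_and !negbK.
  have : has (fun jy : 'I_m * 'rV_d => jy.1 == j) (omega l).
    by move: Mjl; rewrite mxE has_count -lt0n.
  move=> /hasP[[j' w] jw /= /eqP j'j]; rewrite j'j in jw.
  have : (lin Q @` supp (proto l)) (v + w).
    rewrite -(psuppE l).2; apply: subset_closure.
    by exists (trtile (proto j) w); [exists (j, w)|exists v].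
  by move=> [z lz _]; apply: l0; exists z.
have empty j : ~ (supp (proto j) !=set0).
  by apply: (empty_pow k0); rewrite gt_eqF.
have nonempty : psupp Tl <> set0.
  by rewrite Tl_all => /seteqP[sub0 _]; exact: (sub0 0 I).
apply: nonempty; rewrite /psupp bigcup0 ?closure0// => T TlT.
have [j [x ->]] := Tl_proto T TlT.
apply/seteqP; split=> // w [v jv _].
by exfalso; apply: (empty j); exists v.
Qed.

Lemma tile_parent (R : realType) (d : nat) (L : finType) (m : nat)
  (proto : 'I_m -> tile R d L) (Q : 'M[R]_d)
  (omega : 'I_m -> seq ('I_m * 'rV[R]_d)) (Tl : set (tile R d L)) :
  (forall i, is_tile (proto i)) -> (forall i, supp (proto i) !=set0) ->
  omegaP Q proto omega Tl = Tl ->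
  exists s : seq 'rV[R]_d, forall i y, Tl (trtile (proto i) y) ->
    exists j z o,
      [/\ Tl (trtile (proto j) z), o \in s & y = z *m Q + o].
Proof.
move=> protoT proto0 TlE.
(* Two indices may name translates of one tile, so [omega] may produce the tile at [y] as a copy of
   [proto k] instead of [proto i]. The vector [u i k] corrects for this; its default 0 is taken only
   when no such vector exists. *)
pose u i k := xget (0 : 'rV[R]_d) [set u | trtile (proto i) u = proto k].
exists [seq u i kw.1 + kw.2 |
  i <- enum 'I_m, kw <- flatten [seq omega j | j <- enum 'I_m]] => i y.
rewrite -{1}TlE => -[[j z] /= Tjz [_ [[k w] kw ->] /= yE]].
exists j, z, (u i k + w); split=> //.
  apply: (allpairs_f (fun i (kw : 'I_m * 'rV[R]_d) => u i kw.1 + kw.2)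
    (x := i) (y := (k, w))); first by rewrite mem_enum.
  by apply/flattenP; exists (omega j); rewrite ?map_f ?mem_enum.
have /(xgetPex 0) : exists v, trtile (proto i) v = proto k.
  exists (y - (w + lin Q z)).
  rewrite -trtileD -yE !trtileD addrA subrr.
  by case: (proto k) => S l; rewrite /trtile /= trset0.
rewrite -/(u i k) => uE.
apply: (trtile_inj (protoT i) (proto0 i)).
by rewrite -yE -uE !trtileD addrA [in RHS]addrC.
Qed.

(** * The functional attached to [beta] and its boundedness *)

Lemma exists_eigenfunctional (R : realType) (n : nat) (Q : 'M[R]_n)
  (p : {poly rat}) (beta : R[i]) (x : 'rV[R]_n) :
  diagonalizable (QC Q) -> irreducible_poly p ->
  (forall z : R[i], ceigen Q z -> root (map_poly ratr p) z) ->
  root (map_poly ratr p) beta -> x != 0 ->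
  exists f : 'rV[R]_n -> R[i],
    [/\ forall u v, f (u + v) = f u + f v,
        forall v, f (v *m Q) = beta * f v
      & f x = 1].
Proof.
case: n Q x => [Q x|n Q x Qdiag p_irr p_eig /rootP p_beta x0].
  by rewrite [x]thinmx0 eqxx.
(* The vanishing is checked over the complex numbers, where [Q] is diagonalizable, and descends
   because the embedding of [R] is injective. *)
have pQ0 : horner_mx Q (map_poly ratr p) = 0.
  have : map_mx (real_complex R) (horner_mx Q (map_poly ratr p)) = 0.
    rewrite map_horner_mx -map_poly_comp.
    rewrite (eq_map_poly (fmorph_eq_rat (real_complex R \o ratr))).
    exact: diagonalizable_horner0.
  by move/eqP; rewrite map_mx_eq0 => /eqP.
have [f [fD fA fx]] := exists_equivariant_functional
  (A := horner_mx Q \o map_poly ratr) (ev := horner_eval beta \o map_poly ratr)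
  p_irr pQ0 p_beta x0.
exists f; split=> // v.
by have := fA 'X v; rewrite /= !map_polyX horner_mx_X /horner_eval hornerX.
Qed.

Lemma bounded_translates (R : realType) (d : nat) (L : finType) (m : nat)
  (proto : 'I_m -> tile R d L) (Q : 'M[R]_d)
  (omega : 'I_m -> seq ('I_m * 'rV[R]_d)) (Tl : set (tile R d L))
  (f : 'rV[R]_d -> R[i]) (beta : R[i]) :
  is_subst_rule Q proto omega -> (forall i, supp (proto i) !=set0) ->
  is_patch Tl -> omegaP Q proto omega Tl = Tl -> diagonalizable (QC Q) ->
  `|beta| < 1 ->
  (forall u v, f (u + v) = f u + f v) ->
  (forall v, f (v *m Q) = beta * f v) ->
  exists C, forall i y, Tl (trtile (proto i) y) -> normc (f y) <= C.
Proof.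
move=> [Qexp [protoT _]] proto0 Tl_patch TlE Qdiag beta1 fD fQ.
have [N [delta [c [delta1 N0 ND NQ N_norm]]]] := expansion_norm Qdiag Qexp.
have [s parent] := tile_parent protoT proto0 TlE.
pose S := [set y | exists i, Tl (trtile (proto i) y)].
(* For each prototile, positions are separated by the radius of a ball inside it, and a bound on [N]
   bounds the norm. *)
have Sfin r : finite_set [set y | S y /\ N y <= r].
  apply: (@sub_finite_set _ _ (\bigcup_(i in [set: 'I_m])
      [set y | Tl (trtile (proto i) y) /\ N y <= r])).
    by move=> y [[i iy] yr]; exists i.
  apply: bigcup_finite => // i _.
  have [a [rho [rho0 sub]]] := tile_contains_ball (protoT i) (proto0 i).
  apply: (separated_bounded_finite rho0) => [|y y' [iy _] [iy' _]].
    exists (`|c| * `|r|); split; first exact: num_real.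
    move=> M /ltW cM y [_ yr]; apply: le_trans cM.
    apply: le_trans (N_norm y) _; apply: le_trans (ler_wpM2r (N0 y) (ler_norm c)) _.
    by rewrite ler_wpM2l// (le_trans yr)// ler_norm.
  exact: (overlapping_translates Tl_patch (protoT i) (proto0 i) sub).
pose g v := normc (f v).
have [|||C SC] :=
  ancestral_bound (S := S) (s := s) (g := g) (b := normc beta)
    delta1 ND NQ Sfin.
- move=> y [i /parent[j [z [t [jz ts yE]]]]].
  by exists z, t; split=> //; exists j.
- apply/andP; split; first by case: (beta) => a b; exact: sqrtr_ge0.
  by rewrite -ltcR.
- by move=> u v; rewrite /g fD fQ -normcM le_normcD.
- by exists C => i y iy; apply: SC; exists i.
Qed.

Theorem theorem3p6 (R : realType) (d : nat) (L : finType) (m : nat)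
  (proto : 'I_m -> tile R d L) (Q : 'M[R]_d)
  (omega : 'I_m -> seq ('I_m * 'rV[R]_d)) (Tl : set (tile R d L))
  (J : nat) (p : {poly rat}) (beta : R[i]) :
  is_subst_rule Q proto omega ->
  primitive omega ->
  subst_FLC Q proto omega ->
  self_affine Q proto omega Tl ->
  diagonalizable (QC Q) ->
  irreducible_poly p ->
  (forall z : R[i], ceigen Q z -> root (map_poly ratr p) z) ->
  (forall z : R[i], ceigen Q z -> mup z (char_poly (QC Q)) = J) ->
  root (map_poly ratr p) beta -> `|beta| < 1 ->
  (forall x : 'rV[R]_d, return_vector Tl x -> x != 0 ->
     exists n0 : nat, forall n : nat, (n0 < n)%N ->
       forall T, Tl T -> ~ Tl (trtile T (x *+ n)))
  /\
  (forall (T : tile R d L) (x : 'rV[R]_d), Tl T -> return_vector Tl x -> x != 0 ->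
     exists2 n0 : nat, (0 < n0)%N &
       ~ legal Tl [set trtile T (x *+ k) | k in [set k : nat | (1 <= k <= n0)%N]]).
Proof.
move=> subst prim _ [[Tl_patch Tl_all] Tl_proto TlE _ _] Qdiag p_irr p_eig _
  p_beta beta1.
have proto0 := primitive_proto_nonempty subst prim Tl_all Tl_proto.
have escape (x : 'rV[R]_d) : x != 0 ->
    exists n0 : nat, forall n : nat, (n0 < n)%N ->
      forall T, Tl T -> ~ Tl (trtile T (x *+ n)).
  move=> x0.
  have [f [fD fQ fx]] := exists_eigenfunctional Qdiag p_irr p_eig p_beta x0.
  have [C fC] := bounded_translates subst proto0 Tl_patch TlE Qdiag beta1 fD fQ.
  (* Two positions of tiles differing by [x *+ n] have [f]-values at distance [n], and both values
     have modulus at most [C]. *)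
  exists (Num.bound (C + C)) => n Cn T /[dup] TlT /Tl_proto[i [y TE]].
  rewrite TE trtileD => /fC fyx; rewrite TE in TlT.
  have f0 : f 0 = 0 by apply: (addIr (f 0)); rewrite -fD !add0r.
  have fMn k : f (x *+ k) = k%:R.
    by elim: k => [|k IH]; rewrite ?mulr0n// mulrS fD fx IH -natr1 addrC.
  have C2 : n%:R <= C + C.
    have nE : n%:R = normc (n%:R : R[i]) by rewrite normcMn normc1.
    rewrite nE -fMn -[f _](addKr (f y)) -fD addrC.
    by rewrite (le_trans (le_normcD _ _))// normcN lerD//; exact: fC TlT.
  have := archi_boundP (le_trans (ler0n _ n) C2); rewrite ltNge => /negP; apply.
  by apply: le_trans C2; rewrite ler_nat ltnW.
split=> [x _|T x TlT _] /escape[n0 n0P]; first by exists n0.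
(* The union starts at [k = 1], so the copies [k = 1] and [k = n0.+2] differ by [x *+ n0.+1], the
   first multiple excluded by [n0P]. *)
exists n0.+2 => // -[y sub].
have in_Tl k : (1 <= k <= n0.+2)%N -> Tl (trtile T (x *+ k + y)).
  move=> kn; apply: sub; exists (trtile T (x *+ k)); last by rewrite trtileD.
  by exists k.
apply: (n0P n0.+1 (ltnSn _) _ (in_Tl 1%N isT)).
rewrite trtileD addrAC -mulrnDr add1n.
by apply: in_Tl; rewrite leqnn.
Qed.
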